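(* Let $1\le p<\infty$ and let $T$ be a leafless tree. Then the backward shift $B$ is hypercyclic on $\mathbb{H}^p_0(T)$ if and only if $\lim_{n\to \infty}\gamma(n)=\infty$.
   Context: $\mathbb{N}_0=\{0,1,2,\dots\}$. A tree $T$ means a connected graph with no cycles, with countably infinitely many vertices, locally finite (every vertex has finitely many adjacent vertices), with a distinguished vertex $\mathrm{o}$ called the root. For a vertex $v$, $|v|$ is the number of edges in the unique path between $\mathrm{o}$ and $v$; $v$ is in level $n$ if $|v|=n$, and $\gamma(n)$ is the number of vertices in level $n$. For $v\neq \mathrm{o}$, $\operatorname{par}(v)$ (the parent of $v$) is the unique vertex $w$ on the path from $v$ to $\mathrm{o}$ with $|w|=|v|-1$; $\operatorname{Chi}(v)$ is the set of children of $v$, i.e. of vertices $u$ with $\operatorname{par}(u)=v$. A leaf is a vertex $v$ with $\operatorname{Chi}(v)=\varnothing$; $T$ is leafless if it has no leaves. $\mathcal{F}$ is the vector space of all complex-valued functions on the set of vertices of $T$. For $f\in\mathcal{F}$ and $n\in\mathbb{N}_0$, $M_p(n,f):=\left(\frac{1}{\gamma(n)}\sum_{|v|=n}|f(v)|^p\right)^{1/p}$. The little Hardy space $\mathbb{H}^p_0(T)$ is the set of $f\in\mathcal{F}$ with $\lim_{n\to\infty}M_p(n,f)=0$; it is a Banach space with the norm $\|f\|:=\sup_{n\in\mathbb{N}_0}M_p(n,f)$. The backward shift $B:\mathcal{F}\to\mathcal{F}$ is the linear map $(Bf)(v)=\sum_{w\in\operatorname{Chi}(v)}f(w)$, where the sum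 is $0$ if $\operatorname{Chi}(v)$ is empty. An operator $A$ on a Banach space $\mathcal{B}$ is called hypercyclic if there is $x\in\mathcal{B}$ whose orbit $\{x,Ax,A^2x,A^3x,\dots\}$ is dense in $\mathcal{B}$. *)

(* Defs.v *)
From HB Require Import structures.
From mathcomp Require Export all_boot all_order all_algebra.
From mathcomp Require Export finmap.
From mathcomp Require Export all_classical all_reals all_analysis.
From mathcomp.real_closed Require Export complex.
Set Implicit Arguments.
Unset Strict Implicit.
Unset Printing Implicit Defensive.
Import Order.TTheory GRing.Theory Num.Theory.
Import numFieldNormedType.Exports.

Local Open Scope classical_set_scope.
Local Open Scope complex_scope.
Local Open Scope ring_scope.

Record rooted_tree (V : countType) := RootedTree {
  adj : rel V;
  root : V;
  adj_sym : symmetric adj;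
  adj_irr : irreflexive adj;
  adj_connected : forall u v : V, exists s, path adj u s /\ last u s = v;
  adj_acyclic : forall c : seq V, (2 < size c)%N -> ~ ucycle adj c;
  vertices_infinite : infinite_set [set: V];
  adj_locally_finite : forall v : V, finite_set [set w | adj v w]
}.

Section Tree.
Context {V : countType}.
Variable T : rooted_tree V.

(* [root T :: s] is a path without repeated vertices from the root to [v];
   it has [size s] edges. *)
Definition root_path (v : V) (s : seq V) : Prop :=
  [/\ path (adj T) (root T) s, uniq (root T :: s) & last (root T) s = v].

(* By connectedness and acyclicity exactly one [s] satisfies [root_path v s],
   so the default value of [xget] is never used. *)
Definition path_to (v : V) : seq V := xget [::] (root_path v).

Definition depth (v : V) : nat := size (path_to v).

Definition level (n : nat) : set V := [set v | depth v = n].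

(* Levels are finite by local finiteness, so [fset_set] is not degenerate. *)
Definition gamma (n : nat) : nat := #|` fset_set (level n)|%fset.

Definition is_parent (w v : V) : Prop :=
  [/\ v <> root T, w \in root T :: path_to v & depth w = (depth v).-1].

Definition children (v : V) : set V := [set u | is_parent v u].

Definition leafless : Prop := forall v : V, children v !=set0.

Section Functions.
Variable R : realType.

(* [children v] is finite, so this is the ordinary finite sum. *)
Definition backward_shift (f : V -> R[i]) : V -> R[i] :=
  fun v => \sum_(w \in children v) f w.

Definition mean (p : R) (n : nat) (f : V -> R[i]) : R :=
  ((gamma n)%:R^-1 * \sum_(v \in level n) ComplexField.Normc.normc (f v) `^ p)
    `^ p^-1.

Definition little_hardy (p : R) : set (V -> R[i]) :=
  [set f | (fun n => mean p n f) @ \oo --> (0 : R)].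

(* For [f] in [little_hardy p] the supremum is over a bounded sequence. *)
Definition hardy_norm (p : R) (f : V -> R[i]) : R :=
  sup (range (fun n => mean p n f)).

End Functions.
End Tree.

(* [A] is given on the ambient space [E] of the normed space [(H, N)], and is not
   required to map [H] into [H] (the backward shift of a tree need not be
   bounded on its little Hardy space). What is required is a vector of [H] whose
   orbit stays in [H] and is dense there; when [A] maps [H] into [H] the first
   requirement is automatic. *)
Definition hypercyclic_on (R : realType) (E : zmodType) (H : set E) (N : E -> R)
    (A : E -> E) : Prop :=
  exists x : E,
    (forall n : nat, H (iter n A x)) /\
    (forall y : E, H y -> forall e : R, 0 < e ->
       exists n : nat, N (iter n A x - y) < e).

(* Main.v *)
Require Import Defs.
Import Order.TTheory GRing.Theory Num.Theory.
Import numFieldNormedType.Exports.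
Local Open Scope classical_set_scope.
Local Open Scope ring_scope.

(** Both directions rest on following one child of each vertex, its [heir]. By
    uniqueness of simple paths ([simple_path_unique], from the absence of cycles)
    every vertex other than the root has exactly one parent, so taking heirs is
    injective and maps level [n] into level [n.+1]; in particular [gamma] is
    nondecreasing.

    Sufficiency. The [forward_shift] moves the value at each vertex to its heir.
    It is a right inverse of the backward shift and preserves the sum of the
    [p]-th powers of the values, moved to the next level. If [gamma] tends to
    infinity, the iterates of the forward shift on a function supported on finitely many
    levels therefore tend to 0 in norm ([power_mean_iter_forward_shift]). As in
    the usual proof that a shift is hypercyclic, a vector is assembled from blocks
    [iter (start k) forward_shift (y k)], where the sequence [y] runs through a
    countable family of finitely supported functions, each taken infinitely often,
    and [start] grows fast enough ([hypercyclic_blocks]). The blocks occupy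
    disjoint ranges of levels, so the mean of any iterated backward shift of this
    vector at a given level involves one block only. No convergence of series and
    no boundedness of the backward shift is needed: that the orbit stays in the
    little Hardy space is read off level by level.

    Necessity. If [gamma] does not tend to infinity it is eventually constant, and
    from some level [n0] on the heir of a vertex is its only child. There the
    backward shift is composition with [heir], so for [v] in level [n0] the values
    at [v] of the orbit of [x] are values of [x] along a ray, which are bounded;
    the orbit stays away from functions with a large value at [v]. *)

Set Implicit Arguments.
Unset Strict Implicit.
Unset Printing Implicit Defensive.

(** * Simple paths and parents *)

(** The first element of [s] that belongs to [t]. *)
Lemma first_common (V : eqType) (s t : seq V) : has (mem t) s ->
  exists q1 z q2, [/\ s = q1 ++ z :: q2, z \in t & ~~ has (mem t) q1].
Proof.
case/split_find => z q1 q2 zt q1t; exists q1, z, q2; split => //.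
by rewrite cat_rcons.
Qed.

Section TreePaths.
Variables (V : countType) (T : rooted_tree V).
Local Notation o := (root T).

(** Two distinct simple paths with the same endpoints would enclose a cycle: if
    they leave [u] through different neighbours, follow the first one up to the
    first vertex [z] it shares with the second, then go back along the second. *)
Lemma simple_path_unique (u : V) (s t : seq V) :
  path (adj T) u s -> uniq (u :: s) -> path (adj T) u t -> uniq (u :: t) ->
  last u s = last u t -> s = t.
Proof.
elim: s u t => [|a s IHs] u [|b t] //=.
- by move=> _ _ _ /andP[ubt _] eq_l; move: ubt; rewrite eq_l mem_last.
- by move=> _ /andP[uas _] _ _ eq_l; move: uas; rewrite -eq_l mem_last.
move=> /andP[ua pas] /andP[uas Uas] /andP[ub pbt] /andP[ubt Ubt] eq_l.
case: (eqVneq a b) => [eq_ab|neq_ab].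
  move: ub pbt ubt Ubt eq_l; rewrite -eq_ab => _ pat _ Uat.
  by move=> /(IHs _ _ pas Uas pat Uat) ->.
exfalso.
have hasz : has (mem (b :: t)) (a :: s).
  by apply/hasP; exists (last a s); [exact: mem_last|rewrite eq_l /= mem_last].
have pa : path (adj T) u (a :: s) by rewrite /= ua.
have pb : path (adj T) u (b :: t) by rewrite /= ub.
have Ua : uniq (u :: a :: s) by rewrite /= uas.
have Ub : uniq (u :: b :: t) by rewrite /= ubt.
have [q1 [z [q2 [defs zbt q1bt]]]] := first_common hasz.
have [r1 [r2 deft]] : exists r1 r2, b :: t = r1 ++ z :: r2.
  by case/splitPr: zbt => r1 r2; exists r1, r2.
move: pa Ua pb Ub q1bt; rewrite defs deft.
rewrite cat_path /= => /and3P[pq1 q1z _] Uq.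
rewrite cat_path /= => /and3P[pr1 r1z _] Ur q1r.
(* [q1] and [r1] are not both empty, so the cycle below has at least 3 vertices:
   otherwise [a] and [b] would both be [z]. *)
have szq : (0 < size q1 + size r1)%N.
  case: q1 r1 defs deft {pq1 q1z Uq q1r pr1 r1z Ur} => [|? ?] [|? ?] //=.
  by move=> [az _] [bz _]; rewrite az bz eqxx in neq_ab.
apply: (@adj_acyclic _ T (u :: rcons q1 z ++ rev r1)).
  by rewrite /= size_cat size_rcons size_rev addSn !ltnS.
apply/andP; split.
  rewrite /= rcons_cat cat_path rcons_path pq1 q1z /= last_rcons.
  have := rev_path (adj T) u (rcons r1 z).
  rewrite last_rcons belast_rcons rev_cons => ->.
  rewrite (eq_path (e' := adj T)) ?rcons_path ?pr1 //.
  by move=> x y; rewrite adj_sym.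
have : uniq (u :: q1 ++ z :: r1) -> uniq (u :: rcons q1 z ++ rev r1).
  by rewrite -cat_rcons /= !mem_cat !cat_uniq mem_rev rev_uniq has_rev.
apply; move: Uq Ur q1r.
rewrite !cons_uniq !cat_uniq !cons_uniq !mem_cat !inE /= !negb_or.
case/andP=> /and3P[-> -> _] /and3P[-> /andP[-> _] _].
case/andP=> /and3P[-> _ _] /and3P[-> /andP[-> _] _] q1r; rewrite !andbT.
apply: contra q1r => /hasP[x xr1 xq1]; apply/hasP; exists x => //.
by rewrite /= mem_cat xr1.
Qed.

(** ** Depth *)

Lemma root_path_exists (v : V) : exists s, root_path T v s.
Proof.
have [s [ps ls]] := adj_connected T o v.
case/shortenP: ps ls => t pt ut _ lt.
by exists t.
Qed.

Lemma root_path_uniq (v : V) (s t : seq V) :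
  root_path T v s -> root_path T v t -> s = t.
Proof.
move=> [ps us ls] [pt ut lt]; apply: (simple_path_unique ps us pt ut).
by rewrite ls lt.
Qed.

Lemma root_path_to (v : V) : root_path T v (path_to T v).
Proof. by apply: xgetPex; exact: root_path_exists. Qed.

Lemma path_to_eq (v : V) (s : seq V) : root_path T v s -> path_to T v = s.
Proof. by apply: root_path_uniq; exact: root_path_to. Qed.

Lemma depth_root : depth T o = 0%N.
Proof. by rewrite /depth (@path_to_eq o [::]). Qed.

Lemma depth_gt0 (v : V) : (0 < depth T v)%N = (v != o).
Proof.
apply/idP/idP => [dv|/eqP v_o].
  by apply/eqP => v_o; rewrite v_o depth_root in dv.
rewrite lt0n size_eq0; apply/eqP => p0.
by have [_ _] := root_path_to v; rewrite p0 /= => /esym.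
Qed.

(** The predecessor of [v] on the path from the root to [v]; it is the parent of
    [v], except that the root is its own predecessor. *)
Definition parent (v : V) : V := last o (belast o (path_to T v)).

Lemma path_to_parent (v : V) :
  v <> o -> path_to T v = rcons (path_to T (parent v)) v.
Proof.
move=> v_o; have := root_path_to v; rewrite /parent.
case/lastP: (path_to T v) => [|s x]; first by case=> _ _ /esym.
rewrite /root_path last_rcons belast_rcons /= rcons_path
  rcons_uniq mem_rcons inE negb_or.
move=> -[/andP[ps _] /andP[/andP[_ os] /andP[_ us]] ->]; congr rcons.
by apply/esym/path_to_eq; split=> //=; rewrite os.
Qed.

Lemma depth_parent (v : V) : v <> o -> depth T v = (depth T (parent v)).+1.
Proof. by move=> v_o; rewrite {1}/depth path_to_parent// size_rcons. Qed.

Lemma adj_parent (v : V) : v <> o -> adj T (parent v) v.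
Proof.
move=> v_o; have [] := root_path_to v.
rewrite path_to_parent// rcons_path => /andP[_ + _ _].
by have [_ _ ->] := root_path_to (parent v).
Qed.

Lemma is_parentP (w v : V) : is_parent T w v <-> v <> o /\ w = parent v.
Proof.
split=> [[v_o wp dw]|[v_o ->]].
  have [s1 [s2 [es ls1]]] :
      exists s1 s2, path_to T v = s1 ++ s2 /\ last o s1 = w.
    by case/splitPl: wp => s1 s2 ls1; exists s1, s2.
  have ps1 : path_to T w = s1.
    apply: path_to_eq; have [] := root_path_to v.
    rewrite es cat_path -cat_cons cat_uniq => /andP[ps1 _] /and3P[us1 _ _] _.
    by split.
  move: es dw; rewrite (depth_parent v_o) /= {1}/depth ps1 path_to_parent//.
  rewrite -cats1 => /eqP + szs1; rewrite eq_sym eqseq_cat// => /andP[/eqP es1 _].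
  by split=> //; rewrite -ls1 es1; have [_ _ ->] := root_path_to (parent v).
split=> //; last by rewrite (depth_parent v_o).
rewrite path_to_parent// inE mem_rcons inE; apply/orP.
have [_ _ lv] := root_path_to (parent v).
have := mem_last o (path_to T (parent v)); rewrite lv inE.
by case/orP => [->|->]; [left|right; rewrite orbT].
Qed.

Lemma childrenE (v : V) : children T v = [set u | u <> o /\ v = parent u].
Proof. by apply/seteqP; split=> u /is_parentP. Qed.

Lemma depth_child (v u : V) : children T v u -> depth T u = (depth T v).+1.
Proof. by rewrite childrenE => -[u_o ->]; exact: depth_parent. Qed.

Lemma finite_children (v : V) : finite_set (children T v).
Proof.
apply: sub_finite_set (adj_locally_finite T v).
by rewrite childrenE => u [u_o ->]; exact: adj_parent.
Qed.

Lemma level_succ (n : nat) :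
  level T n.+1 = \bigcup_(v in level T n) children T v.
Proof.
apply/seteqP; split=> [u un|u [v <- /depth_child]//].
have u_o : u <> o by apply/eqP; rewrite -depth_gt0 (un : depth T u = _).
exists (parent u); last by rewrite childrenE.
by apply: succn_inj; rewrite -depth_parent.
Qed.

Lemma finite_level (n : nat) : finite_set (level T n).
Proof.
elim: n => [|n IHn].
  apply: (@sub_finite_set _ _ [set o]); last exact: finite_set1.
  move=> v v0; apply/eqP.
  by rewrite -[_ == _]negbK -depth_gt0 (v0 : depth T v = _).
by rewrite level_succ; apply: bigcup_finite => // v _; exact: finite_children.
Qed.

End TreePaths.

(** * Power means on the levels *)

Lemma ler_fsum (R : numDomainType) (I : choiceType) (A : set I) (F G : I -> R) :
  finite_set A -> (forall i, A i -> F i <= G i) ->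
  \sum_(i \in A) F i <= \sum_(i \in A) G i.
Proof.
move=> Afin FG; rewrite !fsbig_finite//= big_seq [leRHS]big_seq.
by apply: ler_sum => i; rewrite in_fset_set// => /set_mem; exact: FG.
Qed.

Section PowerMeans.
Variables (R : realType) (V : countType) (T : rooted_tree V).
Variable p : R.
Hypothesis p1 : 1 <= p.
Local Notation o := (root T).
Local Notation normc := (@ComplexField.Normc.normc R).
Implicit Types (f g : V -> R[i]) (n l m : nat).

Let p_gt0 : 0 < p. Proof. exact: lt_le_trans ltr01 p1. Qed.

Lemma normc_ge0 (z : R[i]) : 0 <= normc z.
Proof. by case: z => a b; exact: sqrtr_ge0. Qed.

(** The unnormalised sum in the definition of [mean]. *)
Definition power_sum n f : R := \sum_(v \in level T n) normc (f v) `^ p.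

(** The [p]-th power of [mean]. *)
Definition power_mean n f : R := (gamma T n)%:R^-1 * power_sum n f.

Lemma meanE n f : mean T p n f = power_mean n f `^ p^-1. Proof. by []. Qed.

Lemma power_sum_ge0 n f : 0 <= power_sum n f.
Proof. by apply: fsumr_ge0 => v _; exact: powR_ge0. Qed.

Lemma power_mean_ge0 n f : 0 <= power_mean n f.
Proof. by rewrite mulr_ge0 ?invr_ge0 ?ler0n ?power_sum_ge0. Qed.

Lemma mean_ge0 n f : 0 <= mean T p n f.
Proof. exact: powR_ge0. Qed.

Lemma mean_powR n f : mean T p n f `^ p = power_mean n f.
Proof.
by rewrite meanE -powRrM mulVf ?gt_eqF// powRr1// power_mean_ge0.
Qed.

Lemma mean_le n f (e : R) : 0 <= e ->
  (mean T p n f <= e) = (power_mean n f <= e `^ p).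
Proof.
move=> e0; rewrite -mean_powR; apply/idP/idP => [|le_p].
  by apply: ge0_ler_powR; rewrite ?nnegrE ?mean_ge0 // ltW.
rewrite -[e]powRr1// -(mulfV (lt0r_neq0 p_gt0)) powRrM meanE.
rewrite -mean_powR; apply: ge0_ler_powR; rewrite ?nnegrE ?powR_ge0//.
by rewrite invr_ge0 ltW.
Qed.

Lemma eq_power_sum n f g : (forall v, depth T v = n -> f v = g v) ->
  power_sum n f = power_sum n g.
Proof. by move=> fg; apply: eq_fsbigr => v /set_mem vn; rewrite fg. Qed.

Lemma eq_power_mean n f g : (forall v, depth T v = n -> f v = g v) ->
  power_mean n f = power_mean n g.
Proof. by move=> fg; rewrite /power_mean (eq_power_sum fg). Qed.

Lemma power_sum0 n f : (forall v, depth T v = n -> f v = 0) ->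
  power_sum n f = 0.
Proof.
move=> f0; apply: fsbig1 => v vn; rewrite f0//.
by rewrite ComplexField.Normc.normc0 powR0 // gt_eqF.
Qed.

Lemma power_mean0 n f : (forall v, depth T v = n -> f v = 0) ->
  power_mean n f = 0.
Proof. by move=> f0; rewrite /power_mean power_sum0// mulr0. Qed.

(** A single value is controlled by the sum over its level. *)
Lemma powR_normc_le_power_sum f (v : V) :
  normc (f v) `^ p <= power_sum (depth T v) f.
Proof.
rewrite /power_sum (fsbigD1 v)//=; last exact: finite_level.
by rewrite lerDl; apply: fsumr_ge0 => w _; exact: powR_ge0.
Qed.

Lemma power_mean_const n f (c : R) : 0 <= c ->
  (forall v, depth T v = n -> normc (f v) <= c) -> power_mean n f <= c `^ p.
Proof.
move=> c0 fc; rewrite /power_mean.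
have sum_le : power_sum n f <= (gamma T n)%:R * c `^ p.
  apply: (@le_trans _ _ (\sum_(v \in level T n) c `^ p)).
    apply: ler_fsum => [|v vn]; first exact: finite_level.
    by apply: ge0_ler_powR; rewrite ?nnegrE ?normc_ge0 ?(ltW p_gt0)// fc.
  rewrite fsbig_finite; last exact: finite_level.
  by rewrite big_const_seq count_predT iter_addr_0 mulr_natl.
have [g0|g0] := eqVneq (gamma T n) 0%N.
  by rewrite g0 invr0 mul0r powR_ge0.
by rewrite mulrC ler_pdivrMr ?ltr0n ?lt0n// mulrC.
Qed.

(** A crude substitute for the Minkowski inequality. *)
Lemma power_mean_add n f g :
  power_mean n (f + g) <= 2 `^ p * (power_mean n f + power_mean n g).
Proof.
rewrite /power_mean -mulrDr mulrCA ler_wpM2l ?invr_ge0 ?ler0n//.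
rewrite /power_sum -fsbig_split; last exact: finite_level.
rewrite mulr_fsumr.
apply: ler_fsum => [|v _]; first exact: finite_level.
wlog fg : f g / normc (f v) <= normc (g v).
  move=> le_sum; have [|/ltW fg] := leP (normc (f v)) (normc (g v)).
    exact: le_sum.
  by rewrite [f + g]addrC [X in _ * X]addrC; exact: le_sum.
apply: (@le_trans _ _ ((2 * normc (g v)) `^ p)).
  apply: ge0_ler_powR;
    rewrite ?nnegrE ?normc_ge0 ?mulr_ge0 ?normc_ge0 ?(ltW p_gt0)//.
  apply: le_trans (le_normcD (f v) (g v)) _.
  by rewrite mulr2n mulrDl mul1r lerD2r.
by rewrite powRM ?normc_ge0// ler_wpM2l ?powR_ge0// lerDr powR_ge0.
Qed.

End PowerMeans.

(** * The backward shift and a right inverse *)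

Section Shift.
Variables (R : realType) (V : countType) (T : rooted_tree V).
Local Notation o := (root T).
Local Notation B := (@backward_shift V T R).
Implicit Types (f g : V -> R[i]) (n m : nat).

(** The [m]-th iterate at [v] only sees the level [m] steps beyond [v]. *)
Lemma iter_backward_shift_local m f g (v : V) :
  (forall w, depth T w = (depth T v + m)%N -> f w = g w) ->
  iter m B f v = iter m B g v.
Proof.
elim: m v => [|m IHm] v fg; first by apply: fg; rewrite addn0.
rewrite !iterS; apply: eq_fsbigr => w /set_mem /depth_child dw.
by apply: IHm => u du; apply: fg; rewrite du dw addSnnS.
Qed.

Hypothesis hT : leafless T.

(** A child of [v], chosen once and for all; one exists as there are no
    leaves. *)
Definition heir (v : V) : V := xget o (children T v).

Lemma heirP (v : V) : children T v (heir v).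
Proof. by apply: xgetPex; exact: hT. Qed.

Lemma parent_heir (v : V) : parent T (heir v) = v.
Proof. by have := heirP v; rewrite childrenE => -[]. Qed.

Lemma depth_heir (v : V) : depth T (heir v) = (depth T v).+1.
Proof. exact: depth_child (heirP v). Qed.

Lemma heir_inj : injective heir.
Proof. exact: can_inj parent_heir. Qed.

Lemma heir_level n : heir @` level T n `<=` level T n.+1.
Proof. by move=> _ [v vn <-]; rewrite /level /= depth_heir vn. Qed.

Lemma gamma_image_heir n : #|` fset_set (heir @` level T n)|%fset = gamma T n.
Proof.
rewrite fset_set_image; last exact: finite_level.
by rewrite card_imfset//; exact: heir_inj.
Qed.

Lemma gamma_leS n : (gamma T n <= gamma T n.+1)%N.
Proof.
rewrite -gamma_image_heir; apply: fsubset_leq_card.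
rewrite -fset_set_sub; [exact: heir_level| |exact: finite_level].
by apply: finite_image; exact: finite_level.
Qed.

Lemma gamma_le : {homo gamma T : m n / (m <= n)%N}.
Proof.
by apply: homo_leq => [//|? ? ?|]; [exact: leq_trans|exact: gamma_leS].
Qed.

(** The value of [f] at each vertex is moved to the heir of that vertex; the
    other children get 0. *)
Definition forward_shift f : V -> R[i] :=
  fun w => if heir (parent T w) == w then f (parent T w) else 0.

Lemma forward_shift_heir f (v : V) : forward_shift f (heir v) = f v.
Proof. by rewrite /forward_shift parent_heir eqxx. Qed.

Lemma forward_shiftK : cancel forward_shift B.
Proof.
move=> f; apply/funext => v; rewrite /backward_shift.
rewrite -(fsbig_widen [set heir v] (children T v)) ?fsbig_set1
  ?forward_shift_heir//.
  by move=> _ ->; exact: heirP.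
move=> w []; rewrite childrenE => -[_ ->] wh; rewrite /= /forward_shift.
by case: eqP => // hw; case: wh.
Qed.

Lemma iter_forward_shiftK m n f : (m <= n)%N ->
  iter m B (iter n forward_shift f) = iter (n - m) forward_shift f.
Proof.
elim: m n => [|m IHm] n mn; first by rewrite subn0.
rewrite iterSr; case: n mn => // n mn.
by rewrite iterS forward_shiftK IHm// subSS.
Qed.

Variable p : R.
Hypothesis p1 : 1 <= p.

Lemma power_sum_forward_shift0 f : power_sum T p 0 (forward_shift f) = 0.
Proof.
apply: power_sum0 => // v v0; rewrite /forward_shift; case: eqP => // hv.
by move: v0; rewrite -hv depth_heir.
Qed.

Lemma power_sum_forward_shiftS n f :
  power_sum T p n.+1 (forward_shift f) = power_sum T p n f.
Proof.
rewrite /power_sum -(fsbig_widen (heir @` level T n)).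
- rewrite fsbig_image; last by move=> ? ? _ _; exact: heir_inj.
  by apply: eq_fsbigr => v _; rewrite forward_shift_heir.
- exact: heir_level.
- move=> w [wn wh] /=; rewrite /forward_shift; case: eqP => [hw|_].
    exfalso; apply: wh; exists (parent T w) => //.
    by apply: succn_inj; rewrite -depth_heir hw.
  by rewrite ComplexField.Normc.normc0 powR0// gt_eqF// (lt_le_trans ltr01).
Qed.

Lemma power_sum_iter_forward_shift n l f :
  power_sum T p l (iter n forward_shift f) =
    if (n <= l)%N then power_sum T p (l - n) f else 0.
Proof.
elim: n l => [|n IHn] [|l] //=; first by rewrite power_sum_forward_shift0.
by rewrite power_sum_forward_shiftS IHn subSS.
Qed.

(** The sum of the [p]-th powers does not change under the forward shift, while
    the levels it reaches grow: the means of the iterates tend to 0, uniformly over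
    the levels. *)
Lemma power_mean_iter_forward_shift f L (e : R) :
  gamma T n @[n --> \oo] --> \oo -> (forall v, (L < depth T v)%N -> f v = 0) ->
  0 < e -> exists N, forall n, (N <= n)%N -> forall l,
    power_mean T p l (iter n forward_shift f) <= e.
Proof.
move=> /cvgnyPge goo fL e0.
pose C := \sum_(i < L.+1) power_sum T p i f.
have fC i : power_sum T p i f <= C.
  have [iL|Li] := ltnP i L.+1.
    rewrite /C (bigD1 (Ordinal iL))//= lerDl; apply: sumr_ge0 => j _.
    exact: power_sum_ge0.
  rewrite power_sum0 // ?sumr_ge0// => [j _|v vi]; first exact: power_sum_ge0.
  by apply: fL; rewrite vi.
have [N _ NP] := goo (Num.truncn (C / e)).+1.
exists N => n Nn l; rewrite /power_mean power_sum_iter_forward_shift.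
case: leqP => [nl|_]; last by rewrite mulr0 ltW.
have gl : C / e < (gamma T l)%:R.
  apply: lt_le_trans (truncnS_gt _) _.
  by rewrite ler_nat; apply: NP; rewrite /= (leq_trans Nn).
have C0 : 0 <= C := le_trans (power_sum_ge0 T p 0 f) (fC 0%N).
have gl0 : 0 < (gamma T l)%:R :> R.
  by rewrite (le_lt_trans _ gl)// divr_ge0// ltW.
rewrite mulrC ler_pdivrMr//; apply: le_trans (fC _) _.
by rewrite mulrC -ler_pdivrMr// ltW.
Qed.

End Shift.

(** * A countable family of finitely supported functions *)

Section FiniteFunctions.
Variables (R : realType) (V : countType).
Local Notation normc := (@ComplexField.Normc.normc R).

(** The function on [V] with value the [i]-th complex rational of [s] at the
    vertex numbered [i], and 0 outside the vertices numbered by [s]. *)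
Definition fun_of_seq (s : seq (rat * rat)) (v : V) : R[i] :=
  let q := nth (0, 0) s (choice.pickle v) in (ratr q.1 +i* ratr q.2)%C.

Lemma fun_of_seq_bounded (d : V -> nat) (s : seq (rat * rat)) :
  exists L, forall v, (L < d v)%N -> fun_of_seq s v = 0.
Proof.
exists (\max_(i < size s) oapp d 0%N (choice.unpickle i)) => v.
have [vs|sv] := ltnP (choice.pickle v) (size s).
  rewrite ltnNge => /negP[].
  have := leq_bigmax (Ordinal vs)
    (F := fun i : 'I__ => oapp d 0%N (choice.unpickle i)).
  by rewrite /= choice.pickleK.
by move=> _; rewrite /fun_of_seq nth_default //= !rmorph0.
Qed.

Lemma complex_rational_dense (z : R[i]) (e : R) : 0 < e ->
  exists q : rat * rat, normc ((ratr q.1 +i* ratr q.2)%C - z) <= e.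
Proof.
case: z => a b e0.
have rat_near (x : R) : exists q : rat, `|ratr q - x| <= e / 2.
  have [|q] := @rat_in_itvoo R x (x + e / 2); first by rewrite ltrDl divr_gt0.
  rewrite in_itv /= => /andP[xq qx]; exists q.
  by rewrite ger0_norm ?subr_ge0 ?ltW// ltrBlDl.
have [q1 aq1] := rat_near a; have [q2 bq2] := rat_near b.
exists (q1, q2) => /=.
have le_re_im (x y : R) : normc (x +i* y)%C <= `|x| + `|y|.
  rewrite /= -[leRHS]ger0_norm ?addr_ge0// -sqrtr_sqr ler_wsqrtr//.
  rewrite sqrrD !real_normK ?num_real// lerD2r lerDl.
  by rewrite mulrn_wge0// mulr_ge0.
apply: le_trans (le_re_im _ _) _.
by rewrite [e]splitr lerD.
Qed.

Lemma fun_of_seq_dense (A : set V) (f : V -> R[i]) (e : R) :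
  finite_set A -> 0 < e -> exists s,
    (forall v, A v -> normc (fun_of_seq s v - f v) <= e) /\
    (forall v, ~ A v -> fun_of_seq s v = 0).
Proof.
move=> Afin e0.
have [q qP] := choice (fun v => complex_rational_dense (f v) e0).
pose N := (\max_(v <- fset_set A) choice.pickle v).+1.
pose s := mkseq (fun i => if choice.unpickle i is Some v then
  if v \in A then q v else (0, 0) else (0, 0)) N.
have sE v : nth (0, 0) s (choice.pickle v) = if v \in A then q v else (0, 0).
  have [vN|Nv] := ltnP (choice.pickle v) N.
    by rewrite nth_mkseq// choice.pickleK.
  rewrite nth_default ?size_mkseq//; case: ifPn => // vA; exfalso.
  move: Nv; rewrite /N ltnNge => /negP; apply.
  by apply: leq_bigmax_seq => //; rewrite in_fset_set.
exists s; split=> v vA; rewrite /fun_of_seq sE.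
  by rewrite mem_set//; exact: qP.
by rewrite memNset//= !rmorph0.
Qed.

End FiniteFunctions.

(** * Sufficiency: assembling a hypercyclic vector *)

Section Blocks.
Variable g : nat -> nat.
Hypothesis g_gt0 : forall k, (0 < g k)%N.

(** The level where block [k] starts when block [i] has length [g i]. *)
Definition start (k : nat) : nat := \sum_(i < k) g i.

Lemma startS k : start k.+1 = (start k + g k)%N.
Proof. exact: big_ord_recr. Qed.

Lemma start_ltS k : (start k < start k.+1)%N.
Proof. by rewrite startS -[ltnLHS]addn0 ltn_add2l. Qed.

Lemma start_le : {homo start : j k / (j <= k)%N}.
Proof.
by apply: homo_leq => [//|? ? ?|k]; [exact: leq_trans|exact/ltnW/start_ltS].
Qed.

Lemma leq_start k : (k <= start k)%N.
Proof. by elim: k => // k IHk; exact: leq_ltn_trans IHk (start_ltS k). Qed.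

Lemma block_exists d : exists k, (start k <= d < start k.+1)%N.
Proof.
elim: d => [|d [k /andP[kd dk]]].
  exists 0%N; rewrite {1}/start big_ord0 /=.
  exact: leq_ltn_trans (start_ltS 0).
have [dk1|] := ltnP d.+1 (start k.+1); first by exists k; rewrite dk1 leqW.
by exists k.+1; rewrite (leq_ltn_trans dk (start_ltS _)) andbT.
Qed.

End Blocks.

Section Sufficiency.
Variables (R : realType) (p : R) (V : countType) (T : rooted_tree V).
Hypotheses (p1 : 1 <= p) (hT : leafless T).
Hypothesis goo : gamma T n @[n --> \oo] --> \oo.
Local Notation B := (@backward_shift V T R).
Local Notation S := (@forward_shift R V T).
Local Notation normc := (@ComplexField.Normc.normc R).

(** The vector is assembled from the functions [iter (start k) S (y k)], which
    live on pairwise disjoint blocks of levels. Applying [B] [m] times moves the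
    blocks with [m <= start k] down to [iter (start k - m) S (y k)]. For
    [m = start j] this is [y j] itself when [k = j] and small when [j < k]. For
    fixed [m] the moved blocks tend to 0 as [k] grows, which keeps the orbit in the
    little Hardy space. *)
Lemma hypercyclic_blocks (y : nat -> V -> R[i]) :
  (forall k, exists L, forall v, (L < depth T v)%N -> y k v = 0) ->
  exists x : V -> R[i],
    (forall m (e : R), 0 < e -> exists N, forall l, (N <= l)%N ->
       power_mean T p l (iter m B x) <= e) /\
    (forall j, exists m, forall l,
       power_mean T p l (iter m B x - y j) <= j.+1%:R^-1).
Proof.
move=> /choice[L yL].
have decay k : exists N, forall n, (N <= n)%N -> forall l,
    power_mean T p l (iter n S (y k.+1)) <= k.+1%:R^-1.
  by apply: (power_mean_iter_forward_shift hT p1 goo (yL _)); rewrite invr_gt0.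
have [N NP] := choice decay.
(* The gap after block [k] leaves room for the support of [y k] and makes
   [iter n S (y k.+1)] small for all [n >= g k]. *)
pose g k := maxn (L k).+1 (N k).
have g_gt0 k : (0 < g k)%N by rewrite /g leq_max.
have [K KP] := choice (block_exists g_gt0).
pose x w := iter (start g (K (depth T w))) S (y (K (depth T w))) w.
have iter_x m l v : depth T v = l ->
    iter m B x v = iter m B (iter (start g (K (l + m))) S (y (K (l + m)))) v.
  by move=> <-; apply: iter_backward_shift_local => w dw; rewrite /x dw.
have small m l k : (m <= start g k)%N -> (k < K (l + m))%N ->
    power_mean T p l (iter m B x) <= k.+1%:R^-1.
  move=> mk kK.
  rewrite (eq_power_mean p
    (g := iter (start g (K (l + m)) - m) S (y (K (l + m))))).
    case: (K (l + m)) kK => // k'; rewrite ltnS => kk'.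
    apply: (@le_trans _ _ k'.+1%:R^-1).
      apply: NP; rewrite startS -addnBAC; last first.
        exact: leq_trans mk (start_le g_gt0 kk').
      by rewrite (leq_trans _ (leq_addl _ _))// leq_maxr.
    by rewrite lef_pV2 ?posrE// ler_nat.
  move=> v vl; rewrite (iter_x _ l)// iter_forward_shiftK//.
  by rewrite (leq_trans mk)// start_le// ltnW.
have le_K k d : (start g k <= d)%N -> (k <= K d)%N.
  move=> kd; rewrite -ltnS ltnNge; apply/negP => Kk.
  have /andP[_] := KP d; rewrite ltnNge => /negP; apply.
  by apply: leq_trans kd; exact: start_le.
exists x; split=> [m e e0|j].
  pose k := maxn m (Num.truncn e^-1).
  exists (start g k.+1) => l kl; apply: (@le_trans _ _ k.+1%:R^-1).
    apply: small; first by rewrite (leq_trans _ (leq_start _ _))// leq_maxl.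
    by apply: le_K; rewrite (leq_trans kl)// leq_addr.
  rewrite -[leRHS]invrK lef_pV2 ?posrE ?invr_gt0// ltW//.
  apply: lt_le_trans (truncnS_gt _) _.
  by rewrite ler_nat ltnS leq_maxr.
exists (start g j) => l.
have := le_K j (l + start g j)%N (leq_addl _ _).
rewrite leq_eqVlt => /orP[/eqP Kj|jK].
  rewrite power_mean0 ?invr_ge0// => v vl.
  by rewrite !fctE (iter_x _ l)// -Kj iter_forward_shiftK// subnn subrr.
rewrite (eq_power_mean p (g := iter (start g j) B x)); first exact: small.
move=> v vl; rewrite !fctE yL ?subr0// vl.
have /andP[+ _] := KP (l + start g j)%N.
move=> /(leq_trans (start_le g_gt0 jK)).
by rewrite startS addnC leq_add2r => /(leq_trans _); apply; exact: leq_maxl.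
Qed.

Lemma hypercyclic_of_gamma :
  hypercyclic_on (little_hardy T p) (hardy_norm T p) B.
Proof.
pose d k := odflt [::] (choice.unpickle (logn 2 k)) : seq (rat * rat).
pose y k : V -> R[i] := fun_of_seq R (d k).
have [|x [x_small x_close]] := @hypercyclic_blocks y.
  by move=> k; exact: fun_of_seq_bounded.
have p_gt0 : 0 < p := lt_le_trans ltr01 p1.
exists x; split=> [m|f fH e e0].
  apply/cvgr0Pnorm_le => e e0.
  have [N NP] := x_small m _ (powR_gt0 p e0).
  exists N => // l /NP le_e.
  by rewrite ger0_norm ?mean_ge0// mean_le// ltW.
(* Two errors of power mean [c] add up, by [power_mean_add], to an error of
   power mean [(e / 2) `^ p]. *)
pose c := (e / 2) `^ p / (2 `^ p * 2).
have c0 : 0 < c by rewrite divr_gt0 ?mulr_gt0 ?powR_gt0// divr_gt0.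
have r0 : 0 < c `^ p^-1 by rewrite powR_gt0.
have rK : (c `^ p^-1) `^ p = c by rewrite -powRrM mulVf ?gt_eqF// powRr1// ltW.
have [M _ MP] : \forall n \near \oo, `|mean T p n f| <= c `^ p^-1.
  by move/cvgr0Pnorm_le: fH; apply.
have tail l : (M <= l)%N -> power_mean T p l f <= c.
  move=> /MP; rewrite ger0_norm ?mean_ge0// mean_le ?rK// ltW//.
pose A := \bigcup_(n in `I_M) level T n.
have Afin : finite_set A.
  by apply: bigcup_finite => // n _; exact: finite_level.
have [s [sA sNA]] := fun_of_seq_dense f Afin r0.
(* [s] occurs in [d] at every index with 2-adic valuation [pickle s]; the odd
   factor makes the index exceed [c^-1]. *)
pose j := (2 ^ choice.pickle s * (Num.truncn c^-1).*2.+1)%N.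
have yj : y j = fun_of_seq R s.
  rewrite /y /d /j lognM ?expn_gt0// pfactorK// logn_coprime.
    by rewrite addn0 choice.pickleK.
  by rewrite coprime2n /= odd_double.
have [m close] := x_close j.
exists m.
have mean_half l : mean T p l (iter m B x - f) <= e / 2.
  rewrite mean_le//; last by rewrite divr_ge0// ltW.
  have -> : iter m B x - f = (iter m B x - y j) + (y j - f).
    by rewrite addrA subrK.
  apply: le_trans (power_mean_add _ p1 _ _ _) _.
  rewrite [leRHS](_ : _ = 2 `^ p * (c + c)); last first.
    by rewrite -[c + c]mulr2n -[c *+ 2]mulr_natr mulrCA /c divfK// gt_eqF//
      mulr_gt0// powR_gt0.
  rewrite ler_wpM2l ?powR_ge0// lerD//.
    apply: le_trans (close l) _.
    rewrite -[leRHS]invrK lef_pV2 ?posrE ?invr_gt0// ltW//.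
    apply: lt_le_trans (truncnS_gt _) _.
    rewrite ler_nat ltnS /j -[leqLHS]mul1n leq_mul ?expn_gt0//.
    by rewrite -addnn -addSn leq_addl.
  rewrite yj; have [lM|Ml] := ltnP l M.
    rewrite -rK; apply: power_mean_const => // [|v vl]; first exact: ltW.
    by apply: sA; exists l.
  rewrite (eq_power_mean p (g := - f)).
    suff -> : power_mean T p l (- f) = power_mean T p l f by exact: tail.
    rewrite /power_mean; congr (_ * _); apply: eq_fsbigr => v _.
    by rewrite [(- f) v](_ : _ = - f v)// normcN.
  move=> v vl; rewrite !fctE sNA ?sub0r// => -[n nM vn].
  by move: Ml; rewrite -vl (vn : depth T v = n) leqNgt nM.
apply: (@le_lt_trans _ _ (e / 2)); last first.
  by rewrite ltr_pdivrMr// ltr_pMr// ltr1n.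
apply: ge_sup; first by exists (mean T p 0 (iter m B x - f)), 0%N.
by move=> _ [l _ <-].
Qed.

End Sufficiency.

(** * Necessity: bounded levels *)

Lemma bounded_homo_eventually_const (u : nat -> nat) (M : nat) :
  {homo u : m n / (m <= n)%N} -> (forall n, (u n <= M)%N) ->
  exists n0, forall n, (n0 <= n)%N -> u n = u n0.
Proof.
move=> u_le uM.
have [|i /asboolP[n <-]|k /asboolP[n0 <-] k_max] :=
  @ex_maxnP (fun i => `[< exists n, u n = i >]) M.
- by exists (u 0%N); apply/asboolP; exists 0%N.
- exact: uM.
exists n0 => n n0n; apply/eqP; rewrite eqn_leq [(u n0 <= u n)%N]u_le// andbT.
by apply: k_max; apply/asboolP; exists n.
Qed.

Section Necessity.
Variables (R : realType) (p : R) (V : countType) (T : rooted_tree V).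
Hypotheses (p1 : 1 <= p) (hT : leafless T).
Local Notation o := (root T).
Local Notation B := (@backward_shift V T R).
Local Notation heir := (heir T).
Local Notation normc := (@ComplexField.Normc.normc R).

Lemma mean_le_hardy_norm (f : V -> R[i]) n :
  little_hardy T p f -> mean T p n f <= hardy_norm T p f.
Proof.
move=> fH; apply: ub_le_sup; last by exists n.
have [M MP] := cvg_has_ub (cvgP _ fH).
exists M => _ [m _ <-]; apply: le_trans (ler_norm _) _.
by apply: MP; exists m.
Qed.

(** Membership in the little Hardy space depends on deep levels only. *)
Lemma little_hardy_eq_deep (f g : V -> R[i]) n0 :
  (forall v, (n0 < depth T v)%N -> f v = g v) ->
  little_hardy T p f -> little_hardy T p g.
Proof.
move=> fg /cvgr0Pnorm_le fH; apply/cvgr0Pnorm_le => e e0.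
have [N _ NP] := fH e e0.
exists (maxn n0.+1 N) => // n; rewrite /= geq_max => /andP[n0n Nn].
rewrite !meanE -(eq_power_mean p (f := f)) -?meanE; first exact: NP.
by move=> v vn; apply: fg; rewrite vn.
Qed.

Section ConstantWidth.
(** From level [n0] on all levels have the same number of vertices. *)
Variable n0 : nat.
Hypothesis gamma_const : forall n, (n0 <= n)%N -> gamma T n = gamma T n0.

Lemma children_heir (v : V) : (n0 <= depth T v)%N ->
  children T v = [set heir v].
Proof.
move=> dv; apply/seteqP; split=> [u uv|_ ->]; last exact: heirP.
have fin n : finite_set (heir @` level T n).
  by apply: finite_image; exact: finite_level.
have /(fset_set_inj (fin _) (finite_level T _)) heir_onto :
    fset_set (heir @` level T (depth T v)) = fset_set (level T (depth T v).+1).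
  apply/eqP; rewrite eqEfcard; apply/andP; split.
    by rewrite -fset_set_sub//; [exact: heir_level|exact: finite_level].
  rewrite gamma_image_heir// -/(gamma T _) (gamma_const dv) gamma_const//.
  exact: leqW.
have [w _ wu] : (heir @` level T (depth T v)) u.
  by rewrite heir_onto; exact: depth_child.
move: uv; by rewrite childrenE -wu /= parent_heir// => -[_ ->].
Qed.

Lemma iter_backward_shift_heir m (f : V -> R[i]) (v : V) :
  (n0 <= depth T v)%N -> iter m B f v = f (iter m heir v).
Proof.
elim: m v => [//|m IHm] v dv.
rewrite iterS /backward_shift children_heir// fsbig_set1 IHm ?iterSr//.
by rewrite depth_heir// leqW.
Qed.

Lemma not_hypercyclic_constant_width :
  ~ hypercyclic_on (little_hardy T p) (hardy_norm T p) B.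
Proof.
move=> [x [xH x_dense]].
have p_gt0 : 0 < p := lt_le_trans ltr01 p1.
pose v := iter n0 heir o.
have depth_iter m w : depth T (iter m heir w) = (depth T w + m)%N.
  by elim: m => [|m IHm]; rewrite ?addn0//= depth_heir// IHm addnS.
have dv : depth T v = n0 by rewrite depth_iter depth_root.
have g_gt0 : 0 < (gamma T n0)%:R :> R.
  rewrite ltr0n cardfs_gt0; apply/fset0Pn; exists v.
  by rewrite in_fset_set ?mem_set//; exact: finite_level.
set g := (gamma T n0)%:R in g_gt0.
(* [D] bounds the values at [v] of the orbit of [x]: [x] is bounded in norm and the
   levels that matter all have [g] vertices. *)
pose D := (g * hardy_norm T p x `^ p) `^ p^-1.
have xD m : normc (iter m B x v) <= D.
  rewrite iter_backward_shift_heir ?dv// /D.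
  rewrite -[leLHS]powRr1 ?normc_ge0// -(mulfV (lt0r_neq0 p_gt0)) powRrM.
  have hn0 : 0 <= hardy_norm T p x.
    exact: le_trans (mean_ge0 T p 0 x) (mean_le_hardy_norm _ (xH 0%N)).
  apply: ge0_ler_powR; rewrite ?nnegrE ?powR_ge0 ?invr_ge0 ?(ltW p_gt0)//.
    by rewrite mulr_ge0 ?powR_ge0// ltW.
  apply: le_trans (powR_normc_le_power_sum T p x _) _.
  rewrite depth_iter dv -[leLHS]mul1r -(mulfV (lt0r_neq0 g_gt0)) -mulrA.
  rewrite ler_wpM2l ?(ltW g_gt0)// {1}/g -(gamma_const (leq_addr m n0)).
  rewrite -/(power_mean _ _ _ _) -mean_powR//.
  apply: ge0_ler_powR; rewrite ?nnegrE ?mean_ge0 ?(ltW p_gt0)//.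
  exact: mean_le_hardy_norm (xH 0%N).
pose y w : R[i] := if w == v then (D + 1)%:C%C else 0.
have yH : little_hardy T p y.
  apply: (@little_hardy_eq_deep (fun=> 0) y n0) => [w|].
    by rewrite /y; case: eqP => // ->; rewrite dv ltnn.
  apply/cvgr0Pnorm_le => e e0; near=> n.
  by rewrite meanE power_mean0// powR0 ?invr_neq0 ?gt_eqF// normr0 ltW.
have [|m] := x_dense y yH (g^-1 `^ p^-1); first by rewrite powR_gt0// invr_gt0.
apply/negP; rewrite -leNgt.
apply: le_trans (mean_le_hardy_norm n0 _); last first.
  apply: (@little_hardy_eq_deep (iter m B x) _ n0) (xH m) => w dw.
  rewrite !fctE /y; case: eqP => [wv|]; last by rewrite subr0.
  by rewrite wv dv ltnn in dw.
rewrite meanE; apply: ge0_ler_powR;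
  rewrite ?nnegrE ?invr_ge0 ?power_mean_ge0 ?(ltW g_gt0) ?(ltW p_gt0)//.
rewrite -[leLHS]mulr1 ler_wpM2l ?invr_ge0 ?(ltW g_gt0)//.
have := powR_normc_le_power_sum T p (iter m B x - y) v.
rewrite dv; apply: le_trans; rewrite [leLHS](_ : 1 = 1 `^ p).
  2: by rewrite powR1.
apply: ge0_ler_powR; rewrite ?nnegrE ?normc_ge0 ?(ltW p_gt0)//.
have D0 : 0 <= D by exact: powR_ge0.
have yv : normc (y v) = D + 1.
  by rewrite /y eqxx /= expr0n addr0 sqrtr_sqr ger0_norm// addr_ge0.
rewrite -(lerD2l D) -yv !fctE.
rewrite -[X in normc X <= _](subKr (iter m B x v)).
apply: le_trans (le_normcD _ _) _.
by rewrite normcN lerD2r.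
Unshelve. all: by end_near. Qed.

End ConstantWidth.

Lemma gamma_of_hypercyclic :
  hypercyclic_on (little_hardy T p) (hardy_norm T p) B ->
  gamma T n @[n --> \oo] --> \oo.
Proof.
move=> hB; apply/cvgnyPge => M; apply: contrapT => not_near.
have gM n : (gamma T n <= M)%N.
  rewrite leqNgt; apply/negP => Mn; apply: not_near.
  by exists n => // k /= nk; rewrite (leq_trans (ltnW Mn))// gamma_le.
have [n0 n0P] := bounded_homo_eventually_const (gamma_le hT) gM.
exact: (not_hypercyclic_constant_width n0P).
Qed.

End Necessity.

Theorem theorem4p3p2 (R : realType) (p : R) (hp : 1 <= p)
    (V : countType) (T : rooted_tree V) (hT : leafless T) :
  hypercyclic_on (little_hardy T p) (hardy_norm T p) (@backward_shift V T R)
  <-> gamma T n @[n --> \oo] --> \oo.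
Proof.
split; first exact: gamma_of_hypercyclic.
exact: hypercyclic_of_gamma.
Qed.
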